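(* Let $n\ge0$. The class-size distribution polynomial for $\sim_2$ on $\{\mathtt a,\mathtt b\}^n$, that is $\sum_{X\in\{\mathtt a,\mathtt b\}^n/{\sim_2}}z^{\#X}$, is equal to $$\sum_{[w]_{\sim_2}\in\{\mathtt a,\mathtt b\}^n/{\sim_2}}z^{\,[q^{\binom{w}{\mathtt{ab}}}]\binom{n}{|w|_{\mathtt a}}_{\!q}},$$ where the exponent does not depend on the choice of representative $w$ of the class.
   Context: $|w|_{\mathtt a}$ is the number of letters $\mathtt a$ in $w$ and $\binom{w}{\mathtt{ab}}$ the number of occurrences of $\mathtt{ab}$ as a scattered subword of $w$. For $u,w\in\{\mathtt a,\mathtt b\}^n$, $u\sim_2w$ iff $|u|_{\mathtt a}=|w|_{\mathtt a}$ and $\binom{u}{\mathtt{ab}}=\binom{w}{\mathtt{ab}}$. The Gaussian binomial coefficient is the polynomial $\binom{c}{d}_q=\prod_{i=1}^d\frac{1-q^{c-d+i}}{1-q^i}$ for $0\le d\le c$; $[q^k]f$ is the coefficient of $q^k$ in $f$. The variable $z$ is an indeterminate. *)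

(* Defs.v *)
From mathcomp Require Import all_boot all_order all_algebra.
From mathcomp Require Import ring.

Set Implicit Arguments.
Unset Strict Implicit.
Unset Printing Implicit Defensive.

Import GRing.Theory.
Local Open Scope ring_scope.

Notation letter := bool (only parsing).
Definition la : letter := false.
Definition lb : letter := true.

Notation word n := (n.-tuple letter).

Definition num_a n (w : word n) : nat := count_mem la w.

(* An occurrence of the scattered subword ab is a pair of positions. *)
Definition num_ab n (w : word n) : nat :=
  #|[set p : 'I_n * 'I_n |
      [&& (p.1 < p.2)%N, tnth w p.1 == la & tnth w p.2 == lb]]|.

Definition sim2 n : rel (word n) :=
  fun u w => (num_a u == num_a w) && (num_ab u == num_ab w).

Definition classes2 n : {set {set word n}} :=
  equivalence_partition (@sim2 n) [set: word n].

(* Only meaningful for d <= c. The leading coefficient of the divisor is 1 or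
   -1, so %/ is Euclidean division over int, and it is exact: gauss_binomE. *)
Definition gauss_binom (c d : nat) : {poly int} :=
  (\prod_(1 <= i < d.+1) (1 - 'X^(c - d + i)))
    %/ (\prod_(1 <= i < d.+1) (1 - 'X^i)).

Lemma lead_coef_1subXn (i : nat) : (0 < i)%N ->
  lead_coef (1 - 'X^i : {poly int}) = -1.
Proof. by move=> i0; rewrite -opprB lead_coefN lead_coefXnsubC. Qed.

Lemma lead_coef_gauss_den (d : nat) :
  lead_coef (\prod_(1 <= i < d.+1) (1 - 'X^i : {poly int}))
    \is a GRing.unit.
Proof.
rewrite lead_coef_prod big_nat rpred_prod // => i /andP[i0 _].
by rewrite lead_coef_1subXn // unitrN1.
Qed.

Lemma gauss_den_dvd (d e : nat) : exists g : {poly int},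
  \prod_(1 <= i < d.+1) (1 - 'X^(e + i)) =
  g * \prod_(1 <= i < d.+1) (1 - 'X^i).
Proof.
elim: d e => [|d IHd] e; first by exists 1; rewrite !big_geq // mulr1.
elim: e => [|e [g2 Hg2]].
  by exists 1; rewrite mul1r; apply: eq_bigr => i _; rewrite add0n.
have [g1 Hg1] := IHd e.+1.
exists ('X^(e.+1) * g1 + g2).
rewrite mulrDl -Hg2 big_nat_recr //= Hg1.
rewrite [in RHS]big_nat_recr //= [\prod_(1 <= i < d.+2) (1 - 'X^(e + i))]big_nat_recl //=.
have -> : \prod_(1 <= i < d.+1) (1 - 'X^(e + i.+1)) =
          g1 * \prod_(1 <= i < d.+1) (1 - 'X^i) :> {poly int}.
  by rewrite -Hg1; apply: eq_bigr => i _; rewrite addSnnS.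
rewrite addn1 exprD; move: (\prod_(_ <= _ < _) _) 'X^(e.+1) 'X^(d.+1) => D x y.
ring.
Qed.

Lemma gauss_binomE (c d : nat) : (d <= c)%N ->
  tofrac (gauss_binom c d) =
  \prod_(1 <= i < d.+1) (tofrac (1 - 'X^(c - d + i)) / tofrac (1 - 'X^i))
  :> {fraction {poly int}}.
Proof.
move=> _; rewrite prodf_div -!rmorph_prod /gauss_binom.
have [g ->] := gauss_den_dvd d (c - d).
have uD := lead_coef_gauss_den d.
rewrite Pdiv.IdomainUnit.mulpK // rmorphM /= mulfK // tofrac_eq0.
by apply: contraTneq uD => ->; rewrite lead_coef0 unitr0.
Qed.

(* Main.v *)
(* Splitting a word at its first letter shows that the generating function of
   num_ab over the words of length n with d letters a satisfies the q-Pascal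
   recurrence; hence it is the Gaussian binomial, and its coefficients count the
   classes of sim2. *)
Require Import Defs.
From mathcomp Require Import all_boot all_order all_algebra.
From mathcomp Require Import ring.
Import GRing.Theory.
Local Open Scope ring_scope.

Definition ab_gf (n d : nat) : {poly int} :=
  \sum_(w : word n | num_a w == d) 'X^(num_ab w).

Lemma num_a_cons n x (w : word n) :
  num_a (cons_tuple x w) = ((x == la) + num_a w)%N.
Proof. by []. Qed.

(** As a double sum of indicators, the count lets the row and the column of the first position be
    split off. *)
Lemma num_ab_sum n (w : word n) :
  num_ab w = (\sum_(i < n) \sum_(j < n)
    [&& (i < j)%N, tnth w i == la & tnth w j == lb])%N.
Proof.
rewrite pair_bigA /num_ab -sum1_card big_mkcond /=.
by apply: eq_bigr => p _; rewrite inE; case: ifP.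
Qed.

Lemma count_lb n (w : word n) : count_mem lb w = (n - num_a w)%N.
Proof.
rewrite -[X in (X - _)%N](size_tuple w) -(count_predC (pred1 la)) addKn.
by apply: eq_count; case.
Qed.

Lemma num_a_le n (w : word n) : (num_a w <= n)%N.
Proof. by rewrite -[leqRHS](size_tuple w) count_size. Qed.

Lemma num_ab_cons n x (w : word n) :
  num_ab (cons_tuple x w) = ((x == la) * (n - num_a w) + num_ab w)%N.
Proof.
rewrite !num_ab_sum big_ord_recl; congr addn.
  (* Row 0 holds the pairs that start at the new letter: one for each [lb] of [w] if [x] is [la],
     none otherwise. *)
  rewrite big_ord_recl /= add0n -count_lb -sum1_count big_tuple [in RHS]big_mkcond.
  rewrite big_distrr; apply: eq_bigr => j _ /=.
  by rewrite tnth0 tnthS; case: (x == la); case: (_ == lb).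
(* In a later row, column 0 vanishes, and the rest is a row of the sum for [w]. *)
apply: eq_bigr => i _; rewrite big_ord_recl /= add0n.
by apply: eq_bigr => j _; rewrite !tnthS /bump /= !add1n ltnS.
Qed.

Lemma big_word_cons n (P : pred (word n.+1)) (F : word n.+1 -> {poly int}) :
  \sum_(w | P w) F w =
  \sum_(w | P (cons_tuple la w)) F (cons_tuple la w) +
  \sum_(w | P (cons_tuple lb w)) F (cons_tuple lb w).
Proof.
rewrite (reindex (fun p : bool * word n => cons_tuple p.1 p.2)) /=; last first.
  exists (fun w => (thead w, behead_tuple w)) => [[x w] _ | w _] /=.
    by congr pair; apply: val_inj.
  by rewrite [RHS]tuple_eta.
rewrite big_mkcond -(pair_bigA _ (fun x w =>
  if P (cons_tuple x w) then F (cons_tuple x w) else 0)) /=.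
(* [big_bool] puts [true], that is [lb], first; hence [addrC]. *)
by rewrite big_bool /= addrC -!big_mkcond.
Qed.

Lemma ab_gf_gt n d : (n < d)%N -> ab_gf n d = 0.
Proof.
by move=> nd; apply: big_pred0 => w; rewrite ltn_eqF // (leq_ltn_trans (num_a_le _ _)).
Qed.

Lemma ab_gfS0 n : ab_gf n.+1 0 = ab_gf n 0.
Proof.
rewrite /ab_gf big_word_cons big_pred0 ?add0r => [|w]; last by rewrite num_a_cons.
by apply: eq_bigr => w _; rewrite num_ab_cons.
Qed.

(** A leading [la] precedes all n - d letters [lb] of the tail; a leading [lb] starts no occurrence.
    If n < d, the truncated exponent is harmless, since [ab_gf n d] is 0. *)
Lemma ab_gfSS n d : ab_gf n.+1 d.+1 = 'X^(n - d) * ab_gf n d + ab_gf n d.+1.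
Proof.
rewrite /ab_gf big_word_cons; congr (_ + _).
  rewrite mulr_sumr; apply: eq_big => [w | w]; rewrite num_a_cons add1n eqSS //.
  by move/eqP=> <-; rewrite num_ab_cons mul1n exprD.
by apply: eq_bigr => w _; rewrite num_ab_cons.
Qed.

Lemma ab_gf00 : ab_gf 0 0 = 1.
Proof.
rewrite /ab_gf (big_pred1 [tuple]) => [|w]; last by rewrite !tuple0 /= [RHS]eq_refl.
by rewrite num_ab_sum big_ord0.
Qed.

Lemma ab_gf0 n : ab_gf n 0 = 1.
Proof. by elim: n => [|n IHn]; rewrite ?ab_gf00 // ab_gfS0. Qed.

Lemma ab_gfnn n : ab_gf n n = 1.
Proof.
elim: n => [|n IHn]; first exact: ab_gf00.
by rewrite ab_gfSS subnn IHn ab_gf_gt // mulr1 addr0.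
Qed.

(** Induction on d, then on e. After the q-Pascal step, with x = X^(e+1) and y = X^(d+1), it comes
    down to 1 - xy = x(1 - y) + (1 - x). *)
Lemma ab_gf_mul d e :
  \prod_(1 <= i < d.+1) (1 - 'X^(e + i)) =
  ab_gf (e + d) d * \prod_(1 <= i < d.+1) (1 - 'X^i).
Proof.
elim: d e => [|d IHd] e; first by rewrite !big_geq // ab_gf0 mulr1.
elim: e => [|e IHe].
  by rewrite ab_gfnn mul1r; apply: eq_bigr => i _; rewrite add0n.
rewrite addnS ab_gfSS addnK addSnnS mulrDl -IHe -addSnnS.
rewrite big_nat_recr //= IHd [in RHS]big_nat_recr //=.
rewrite [\prod_(1 <= i < d.+2) (1 - 'X^(e + i))]big_nat_recl //=.
(* Without its factor 1 - X^(e+1), this product is the one for e+1 and d, so [IHd] applies to it as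
   well. *)
under [X in _ + _ * X]eq_bigr do rewrite -addSnnS.
rewrite IHd addn1 exprD.
move: (\prod_(_ <= _ < _) _) 'X^(e.+1) 'X^(d.+1) => D x y.
ring.
Qed.

Lemma gauss_binom_ab_gf n d : (d <= n)%N -> gauss_binom n d = ab_gf n d.
Proof.
move=> dn; rewrite /gauss_binom ab_gf_mul subnK //.
by rewrite Pdiv.IdomainUnit.mulpK // lead_coef_gauss_den.
Qed.

(** A word contributes to this coefficient of [ab_gf] exactly when it shares both invariants with
    [w]. *)
Lemma coef_gauss_binom n (w : word n) :
  (gauss_binom n (num_a w))`_(num_ab w) = #|[set u | sim2 w u]|%:Z.
Proof.
rewrite gauss_binom_ab_gf ?num_a_le // coef_sum -sum1_card -natz natr_sum.
rewrite big_mkcond [RHS]big_mkcond; apply: eq_bigr => u _.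
rewrite inE /sim2 coefXn eq_sym.
by case: (_ == _) => //=; case: (_ == _).
Qed.

Lemma sim2_equiv n : equivalence_rel (@sim2 n).
Proof.
by move=> u v w; split; rewrite /sim2 ?eqxx // => /andP[/eqP-> /eqP->].
Qed.

Lemma classes2E {n X} {w : word n} :
  X \in classes2 n -> w \in X -> X = [set u | sim2 w u].
Proof.
case/imsetP=> v _ ->; rewrite !inE /= => vw.
(* By transitivity, the class of [v] can be recentred at its member [w]. *)
by apply/setP=> u; rewrite !inE /= ((sim2_equiv n v w u).2 vw).
Qed.

Theorem corollary6 (n : nat) :
  [/\ forall w : word n, 0 <= (gauss_binom n (num_a w))`_(num_ab w),
      forall u w : word n, sim2 u w ->
        (gauss_binom n (num_a u))`_(num_ab u) =
        (gauss_binom n (num_a w))`_(num_ab w)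
    & forall rep : {set word n} -> word n,
        (forall X, X \in classes2 n -> rep X \in X) ->
        \sum_(X in classes2 n) 'X^#|X| =
        \sum_(X in classes2 n)
          'X^(absz (gauss_binom n (num_a (rep X)))`_(num_ab (rep X)))
        :> {poly int}].
Proof.
split=> [w | u w /andP[/eqP-> /eqP->] // | rep repP].
  by rewrite coef_gauss_binom.
(* The sums agree term by term: the coefficient at [rep X] is the size of the class of [rep X],
   which is [X]. *)
apply: eq_bigr => X XC.
by rewrite coef_gauss_binom absz_nat -(classes2E XC (repP X XC)).
Qed.
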